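(* Let $\mu\ge 2\eta$ and $\gamma_0=f_1^{-1}(0)$. (i) If $\gamma>\gamma_0$, then with $b_2=b_2^\gamma:=\inf\{x>0: v'(x)<1\}=g_1^{-1}(f_1(\gamma))$ the function $$v(x)=\begin{cases}c_{1,1}(b_2)h_1(x)&x\in(0,b_2),\\ c_{1,2}(b_2)e^{\lambda_\gamma[x-b_2]}+\frac{\gamma}{\gamma+\delta}\big[x-b_2+v(b_2)+\frac{\eta}{\gamma+\delta}\big]&x\in[b_2,\infty),\end{cases}$$ where $v(b_2)=c_{1,1}(b_2)h_1(b_2)$ (and $v(0)=0$), is a $C^2$, increasing and concave solution on $(0,\infty)$ of the HJB equation (see context). Furthermore, $v'/v''$ is decreasing on $(0,\infty)$ and $b_1^\gamma:=\inf\{x>0:-\frac{\mu}{\sigma^2}\frac{v'(x)}{v''(x)}\ge1\}=0$. (ii) If $0<\gamma<\gamma_0$, then $$v(x)=-\frac{\gamma\eta}{(\gamma+\delta)^2}e^{\lambda_\gamma x}+\frac{\gamma}{\gamma+\delta}\Big\{x+\frac{\eta}{\gamma+\delta}\Big\},\quad x\ge0,$$ is a $C^2$, increasing and concave solution of the HJB equation, with $b_2^\gamma:=\inf\{x>0:v'(x)<1\}=0$. Furthermore, $v'/v''$ is decreasing on $(0,\infty)$ and $b_1^\gamma:=\inf\{x>0:-\frac{\mu}{\sigma^2}\frac{v'(x)}{v''(x)}\ge1\}=0$.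
   Context: Constants: $\mu>\eta>0$, $\sigma>0$, $\delta>0$, $\gamma>0$. HJB equation: $$\max_{0\le u\le 1,\;0\le\xi\le x}\Big\{\tfrac12\sigma^2u^2v''(x)+[\eta-(1-u)\mu]v'(x)-\delta v(x)+\gamma[\xi+v(x-\xi)-v(x)]\Big\}=0\ \ (x>0),\qquad v(0)=0.$$ $\lambda_\gamma$ is the negative root of $\frac{\sigma^2}{2}r^2+\eta r-(\delta+\gamma)=0$; $\theta_+>0>\theta_-$ are the roots of $\frac{\sigma^2}{2}r^2+\eta r-\delta=0$. $h_1(x)=e^{\theta_+x}-e^{\theta_-x}$ and $g_1(b)=h_1(b)/h_1'(b)$ for $b>0$; $g_1$ is strictly increasing from $g_1(0+)=0$ to $g_1(\infty)=1/\theta_+$, and $g_1^{-1}$ is its inverse. $f_1(\gamma)=\frac{1}{\lambda_\gamma\delta}\big[\delta+\frac{\lambda_\gamma\eta\gamma}{\delta+\gamma}\big]=\frac{\eta\gamma}{\delta(\delta+\gamma)}-\frac{\sigma^2}{\eta+\sqrt{\eta^2+2\sigma^2(\delta+\gamma)}}$ for $\gamma>0$; $f_1$ is strictly increasing with $f_1(0+)=1/\theta_-<0$ and $f_1(\infty)=\eta/\delta<1/\theta_+$, so $\gamma_0$ is its unique positive zero. $$c_{1,1}(b_2)=\frac{\frac{\gamma}{\gamma+\delta}\big[1-\frac{\eta\lambda_\gamma}{\gamma+\delta}\big]}{h_1'(b_2)-\frac{\delta\lambda_\gamma}{\gamma+\delta}h_1(b_2)},\qquad c_{1,2}(b_2)=\frac{1}{\gamma+\delta}\Big[\delta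 c_{1,1}(b_2)h_1(b_2)-\frac{\gamma\eta}{\gamma+\delta}\Big].$$ *)

(* Defs.v *)
From Stdlib Require Import Reals Lra.
From Coquelicot Require Import Coquelicot.
Open Scope R_scope.

(** [iota P] is meaningful when exactly one real satisfies [P]:
    [iota_correct : (exists! x, P x) -> P (iota P)]. *)

Definition quad (eta sigma c r : R) : R := sigma ^ 2 / 2 * r ^ 2 + eta * r - c.

Definition theta_plus (eta sigma delta : R) : R :=
  iota (fun r : R => 0 < r /\ quad eta sigma delta r = 0).

Definition theta_minus (eta sigma delta : R) : R :=
  iota (fun r : R => r < 0 /\ quad eta sigma delta r = 0).

Definition lambda (eta sigma delta gamma : R) : R :=
  iota (fun r : R => r < 0 /\ quad eta sigma (delta + gamma) r = 0).

Definition h1 (eta sigma delta x : R) : R :=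
  exp (theta_plus eta sigma delta * x) - exp (theta_minus eta sigma delta * x).

Definition g1 (eta sigma delta b : R) : R :=
  h1 eta sigma delta b / Derive (h1 eta sigma delta) b.

(** Inverse of [g1] viewed as a function on the positive half-line. *)
Definition g1_inv (eta sigma delta y : R) : R :=
  iota (fun b : R => 0 < b /\ g1 eta sigma delta b = y).

Definition f1 (eta sigma delta gamma : R) : R :=
  let l := lambda eta sigma delta gamma in
  1 / (l * delta) * (delta + l * eta * gamma / (delta + gamma)).

(** [f1^{-1}(0)], where [f1] is a function on the positive half-line. *)
Definition gamma0 (eta sigma delta : R) : R :=
  iota (fun g : R => 0 < g /\ f1 eta sigma delta g = 0).

Definition c11 (eta sigma delta gamma b2 : R) : R :=
  let l := lambda eta sigma delta gamma in
  (gamma / (gamma + delta) * (1 - eta * l / (gamma + delta))) /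
  (Derive (h1 eta sigma delta) b2
     - delta * l / (gamma + delta) * h1 eta sigma delta b2).

Definition c12 (eta sigma delta gamma b2 : R) : R :=
  1 / (gamma + delta) *
  (delta * c11 eta sigma delta gamma b2 * h1 eta sigma delta b2
     - gamma * eta / (gamma + delta)).

(** A function on [0, oo), extended by 0 to the negative reals. *)
Definition v_large (eta sigma delta gamma b2 x : R) : R :=
  if Rle_dec x 0 then 0
  else if Rlt_dec x b2 then
    c11 eta sigma delta gamma b2 * h1 eta sigma delta x
  else
    c12 eta sigma delta gamma b2
      * exp (lambda eta sigma delta gamma * (x - b2))
    + gamma / (gamma + delta)
      * (x - b2 + c11 eta sigma delta gamma b2 * h1 eta sigma delta b2
         + eta / (gamma + delta)).

(** A function on [0, oo), extended to the negative reals by the same formula, so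
    that two-sided derivatives at 0 are the one-sided ones. *)
Definition v_small (eta sigma delta gamma x : R) : R :=
  - (gamma * eta / (gamma + delta) ^ 2)
    * exp (lambda eta sigma delta gamma * x)
  + gamma / (gamma + delta) * (x + eta / (gamma + delta)).

Definition is_maximum (E : R -> Prop) (m : R) : Prop :=
  E m /\ is_upper_bound E m.

Definition hjb_operand (mu eta sigma delta gamma : R) (v : R -> R)
    (x u xi : R) : R :=
  1 / 2 * sigma ^ 2 * u ^ 2 * Derive_n v 2 x
  + (eta - (1 - u) * mu) * Derive v x
  - delta * v x
  + gamma * (xi + v (x - xi) - v x).

Definition solves_HJB (mu eta sigma delta gamma : R) (v : R -> R) : Prop :=
  (forall x : R, 0 < x ->
     is_maximum
       (fun y : R => exists u xi : R,
          0 <= u <= 1 /\ 0 <= xi <= x /\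
          y = hjb_operand mu eta sigma delta gamma v x u xi)
       0)
  /\ v 0 = 0.

(** [ex_derive_n v 2 x] alone does not imply [ex_derive v x], hence the
    quantification over all orders up to 2. *)
Definition C2_on (D : R -> Prop) (v : R -> R) : Prop :=
  forall x : R, D x ->
    (forall k : nat, (k <= 2)%nat -> ex_derive_n v k x)
    /\ continuous (Derive_n v 2) x.

Definition increasing_on (D : R -> Prop) (v : R -> R) : Prop :=
  forall x y : R, D x -> D y -> x < y -> v x < v y.

Definition decreasing_on (D : R -> Prop) (v : R -> R) : Prop :=
  forall x y : R, D x -> D y -> x < y -> v y < v x.

Definition concave_on (D : R -> Prop) (v : R -> R) : Prop :=
  forall x y t : R, D x -> D y -> 0 <= t <= 1 ->
    t * v x + (1 - t) * v y <= v (t * x + (1 - t) * y).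

(** The quotient [v'/v''] is well defined and decreasing on [D]; without the
    first conjunct the total division could hide a zero of [v'']. *)
Definition ratio_decreasing_on (D : R -> Prop) (v : R -> R) : Prop :=
  (forall x : R, D x -> Derive_n v 2 x <> 0)
  /\ decreasing_on D (fun x : R => Derive v x / Derive_n v 2 x).

(** [Glb_Rbar] is the infimum in the extended reals ([p_infty] on the empty
    set). *)
Definition b2_of (v : R -> R) : Rbar :=
  Glb_Rbar (fun x : R => 0 < x /\ Derive v x < 1).

Definition b1_of (mu sigma : R) (v : R -> R) : Rbar :=
  Glb_Rbar (fun x : R =>
    0 < x /\ - (mu / sigma ^ 2) * (Derive v x / Derive_n v 2 x) >= 1).

(* Main.v *)
(** With the free boundary inserted, [c11 b2 = 1 / h1' b2] and
    [c12 b2 = delta / (lambda (gamma + delta))], so that [v' b2 = 1] on both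
    sides; as [v] and [v'] match at [b2], so does [v''], by the two differential
    equations. Hence [v] is, on [0, oo), the restriction of a [C^2] function on
    the whole line. Concavity and [v' b2 = 1] make [max (x - b2) 0] the optimal
    payment. The equation at [0] gives [v'/v'' = - sigma^2 / (2 eta)] there, and
    since [v'/v''] decreases and [mu >= 2 eta], the maximum over [u] is at
    [u = 1]. The zero of [f1] is explicit:
    [gamma0 = sigma^2 delta^2 / (2 eta^2)]. *)

Require Import Defs.
From Stdlib Require Import Reals Lra Lia.
From Coquelicot Require Import Coquelicot.
Open Scope R_scope.

(** * Calculus: functions with explicit derivatives, and gluing at a point *)

(** The derivatives are named functions on the whole line, so that gluing and the mean value theorem
    meet neither [Derive] nor one-sided limits. *)
Record C2_with (w w1 w2 : R -> R) : Prop := {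
  C2_derive1 : forall x, is_derive w x (w1 x);
  C2_derive2 : forall x, is_derive w1 x (w2 x);
  C2_cont : forall x, continuous w2 x
}.

Lemma mean_value (f df : R -> R) (a b : R) :
  (forall x, is_derive f x (df x)) -> a <= b ->
  exists c, a <= c <= b /\ f b - f a = df c * (b - a).
Proof.
  intros Hf Hab.
  destruct (MVT_gen f a b df) as [c Hc].
  - intros x _; apply Hf.
  - intros x _; apply derivable_continuous_pt.
    exists (df x); apply is_derive_Reals, Hf.
  - rewrite Rmin_left, Rmax_right in Hc by lra.
    exists c; exact Hc.
Qed.

Definition glue (b : R) (f g : R -> R) (x : R) : R :=
  if Rlt_dec x b then f x else g x.

Lemma glue_lt (b : R) (f g : R -> R) (x : R) : x < b -> glue b f g x = f x.
Proof. unfold glue; destruct (Rlt_dec x b); lra. Qed.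

Lemma glue_ge (b : R) (f g : R -> R) (x : R) : b <= x -> glue b f g x = g x.
Proof. unfold glue; destruct (Rlt_dec x b); lra. Qed.

Lemma glue_le (b : R) (f g : R -> R) (x : R) :
  f b = g b -> x <= b -> glue b f g x = f x.
Proof.
  intros E [H | ->]; [now apply glue_lt |].
  rewrite glue_ge; lra.
Qed.

Lemma locally_glue_lt (b : R) (f g : R -> R) (x : R) :
  x < b -> locally x (fun y => f y = glue b f g y).
Proof.
  intros H; apply (locally_interval _ x m_infty b); simpl; auto.
  intros y _ Hy; now rewrite glue_lt.
Qed.

Lemma locally_glue_gt (b : R) (f g : R -> R) (x : R) :
  b < x -> locally x (fun y => g y = glue b f g y).
Proof.
  intros H; apply (locally_interval _ x b p_infty); simpl; auto.
  intros y Hy _; rewrite glue_ge; [reflexivity | now apply Rlt_le].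
Qed.

Lemma continuous_glue (b : R) (f g : R -> R) :
  f b = g b -> (forall x, continuous f x) -> (forall x, continuous g x) ->
  forall x, continuous (glue b f g) x.
Proof.
  intros E Hf Hg x.
  destruct (Rtotal_order x b) as [H | [-> | H]].
  - eapply continuous_ext_loc; [now apply locally_glue_lt | apply Hf].
  - apply filterlim_locally; intros eps.
    pose proof (proj1 (filterlim_locally f (f b)) (Hf b) eps) as Lf.
    pose proof (proj1 (filterlim_locally g (g b)) (Hg b) eps) as Lg.
    generalize (filter_and _ _ Lf Lg); apply filter_imp; intros y [Bf Bg].
    rewrite (glue_ge b f g b) by lra.
    unfold glue; destruct (Rlt_dec y b); congruence.
  - eapply continuous_ext_loc; [now apply locally_glue_gt | apply Hg].
Qed.

(** At [b] the difference quotient is that of [f] for negative increments and that of [g] for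
    positive ones; both tend to [df b = dg b], and the smaller of the two radii serves both
    sides. *)
Lemma is_derive_glue (b : R) (f g df dg : R -> R) :
  f b = g b -> df b = dg b ->
  (forall x, is_derive f x (df x)) -> (forall x, is_derive g x (dg x)) ->
  forall x, is_derive (glue b f g) x (glue b df dg x).
Proof.
  intros E E' Hf Hg x.
  destruct (Rtotal_order x b) as [H | [-> | H]].
  - rewrite glue_lt by lra.
    eapply is_derive_ext_loc; [now apply locally_glue_lt | apply Hf].
  - rewrite (glue_ge b df dg b) by lra.
    pose proof (proj1 (is_derive_Reals _ _ _) (Hf b)) as Df.
    pose proof (proj1 (is_derive_Reals _ _ _) (Hg b)) as Dg.
    apply is_derive_Reals; intros eps He.
    destruct (Df eps He) as [d1 D1], (Dg eps He) as [d2 D2].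
    assert (Hd : 0 < Rmin d1 d2) by (apply Rmin_pos; apply cond_pos).
    exists (mkposreal _ Hd); simpl; intros h Hh Hlt.
    pose proof (Rmin_l d1 d2); pose proof (Rmin_r d1 d2).
    rewrite (glue_ge b f g b) by lra.
    destruct (Rlt_dec (b + h) b).
    + rewrite glue_lt, <- E, <- E' by lra; apply D1; lra.
    + rewrite glue_ge by lra; apply D2; lra.
  - rewrite glue_ge by lra.
    eapply is_derive_ext_loc; [now apply locally_glue_gt | apply Hg].
Qed.

Lemma C2_with_glue (b : R) (f f1 f2 g g1 g2 : R -> R) :
  f b = g b -> f1 b = g1 b -> f2 b = g2 b ->
  C2_with f f1 f2 -> C2_with g g1 g2 ->
  C2_with (glue b f g) (glue b f1 g1) (glue b f2 g2).
Proof.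
  intros E0 E1 E2 [F1 F2 F3] [G1 G2 G3]; split.
  - now apply is_derive_glue.
  - now apply is_derive_glue.
  - now apply continuous_glue.
Qed.

(** * Transfer of derivatives along local equality *)

Section LocalDerivatives.

Context (v w w1 w2 : R -> R) (Hw : C2_with w w1 w2).

Lemma Derive_of_C2 (x : R) :
  locally x (fun y => v y = w y) -> Derive v x = w1 x.
Proof.
  intros H; rewrite (Derive_ext_loc _ _ _ H).
  apply is_derive_unique, (C2_derive1 _ _ _ Hw).
Qed.

Lemma Derive_2_of_C2 (x : R) :
  locally x (fun y => v y = w y) -> Derive_n v 2 x = w2 x.
Proof.
  intros H; rewrite (Derive_n_ext_loc _ _ 2 _ H); simpl.
  rewrite (Derive_ext _ w1).
  - apply is_derive_unique, (C2_derive2 _ _ _ Hw).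
  - intros y; apply is_derive_unique, (C2_derive1 _ _ _ Hw).
Qed.

Lemma C2_on_of_C2 (D : R -> Prop) :
  (forall x, D x -> locally x (fun y => v y = w y)) -> C2_on D v.
Proof.
  intros HD x Dx; split.
  - intros k Hk; apply (ex_derive_n_ext_loc w).
    + generalize (HD x Dx); apply filter_imp; congruence.
    + destruct k as [| [| k]].
      * exact I.
      * exists (w1 x); apply (C2_derive1 _ _ _ Hw).
      * replace k with 0%nat by lia.
        exists (w2 x); simpl; apply (is_derive_ext w1).
        -- intros y; symmetry; apply is_derive_unique, (C2_derive1 _ _ _ Hw).
        -- apply (C2_derive2 _ _ _ Hw).
  - apply (continuous_ext_loc _ w2); [| apply (C2_cont _ _ _ Hw)].
    (* Continuity at [x] needs [Derive_n v 2 = w2] on a neighbourhood, hence local equality at every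
       point near [x]. *)
    generalize (locally_locally _ _ (HD x Dx)).
    apply filter_imp; intros y Hy; symmetry; now apply Derive_2_of_C2.
Qed.

End LocalDerivatives.

(** The data left to check once the free boundary [b] is guessed: the HJB
    equation with [u = 1] and the payment [max (x - b) 0] inserted, and the
    smooth-fit condition [w' = 1] at [b] (only [w' <= 1] if [b = 0]). *)
Record candidate (eta sigma delta gamma b : R) (w w1 w2 : R -> R) : Prop := {
  cand_C2 : C2_with w w1 w2;
  cand_b : 0 <= b;
  cand_0 : w 0 = 0;
  cand_fit : (0 < b /\ w1 b = 1) \/ (b = 0 /\ w1 b < 1);
  cand_pos : forall x, 0 <= x -> 0 < w1 x;
  cand_neg : forall x, 0 <= x -> w2 x < 0;
  cand_ratio : forall x y, 0 <= x -> x < y -> w1 y / w2 y < w1 x / w2 x;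
  cand_left : forall x, 0 <= x <= b ->
    sigma ^ 2 / 2 * w2 x + eta * w1 x - delta * w x = 0;
  cand_right : forall x, b <= x ->
    sigma ^ 2 / 2 * w2 x + eta * w1 x - delta * w x
    + gamma * (x - b + w b - w x) = 0
}.

(** * Verification: what follows from the conditions on a candidate *)

Section Verification.

Context (mu eta sigma delta gamma b : R) (v w w1 w2 : R -> R).
Context (Heta : 0 < eta) (Hsigma : 0 < sigma) (Hgamma : 0 < gamma)
  (Hmu : 2 * eta <= mu).
Context (Hw : candidate eta sigma delta gamma b w w1 w2).
Context (Hv : forall x, 0 <= x -> v x = w x).

Lemma cand_agree (x : R) : 0 < x -> locally x (fun y => v y = w y).
Proof.
  intros H; apply (locally_interval _ x 0 p_infty); simpl; auto.
  intros y Hy _; apply Hv; now apply Rlt_le.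
Qed.

Lemma cand_Derive (x : R) : 0 < x -> Derive v x = w1 x.
Proof.
  intros H; eapply Derive_of_C2; [apply (cand_C2 _ _ _ _ _ _ _ _ Hw) |].
  now apply cand_agree.
Qed.

Lemma cand_Derive_2 (x : R) : 0 < x -> Derive_n v 2 x = w2 x.
Proof.
  intros H; eapply Derive_2_of_C2; [apply (cand_C2 _ _ _ _ _ _ _ _ Hw) |].
  now apply cand_agree.
Qed.

Lemma cand_derive_decr (x y : R) : 0 <= x -> x < y -> w1 y < w1 x.
Proof.
  intros Hx Hxy; destruct Hw as [C2 _ _ _ _ Hneg _ _ _].
  destruct (mean_value w1 w2 x y (C2_derive2 _ _ _ C2)) as [c [Hc E]]; [lra |].
  pose proof (Hneg c ltac:(lra)); nra.
Qed.

Lemma cand_incr (x y : R) : 0 <= x -> x < y -> w x < w y.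
Proof.
  intros Hx Hxy; destruct Hw as [C2 _ _ _ Hpos _ _ _ _].
  destruct (mean_value w w1 x y (C2_derive1 _ _ _ C2)) as [c [Hc E]]; [lra |].
  pose proof (Hpos c ltac:(lra)); nra.
Qed.

(** The slope of a chord is a value of the decreasing [w1] between its end points. Both concavity
    and the optimality of the payment are drawn from this tangent bound. *)
Lemma cand_tangent (x z : R) : 0 <= x -> 0 <= z -> w x <= w z + w1 z * (x - z).
Proof.
  intros Hx Hz.
  pose proof (C2_derive1 _ _ _ (cand_C2 _ _ _ _ _ _ _ _ Hw)) as D1.
  assert (Hd : forall s t, 0 <= s -> s <= t -> w1 t <= w1 s).
  { intros s t Hs [Hst | ->]; [now apply Rlt_le, cand_derive_decr | lra]. }
  destruct (Rle_dec x z).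
  - destruct (mean_value w w1 x z D1) as [c [Hc E]]; [lra |].
    pose proof (Hd c z ltac:(lra) ltac:(lra)); nra.
  - destruct (mean_value w w1 z x D1) as [c [Hc E]]; [lra |].
    pose proof (Hd z c ltac:(lra) ltac:(lra)); nra.
Qed.

Lemma cand_increasing : increasing_on (fun x => 0 <= x) v.
Proof.
  intros x y Hx Hy Hxy; rewrite !Hv by lra; now apply cand_incr.
Qed.

(** In the weighted sum of the two tangent bounds at [z] the linear terms cancel. *)
Lemma cand_concave : concave_on (fun x => 0 <= x) v.
Proof.
  intros x y t Hx Hy Ht.
  set (z := t * x + (1 - t) * y).
  assert (Hz : 0 <= z) by (unfold z; nra).
  rewrite !Hv by lra.
  pose proof (cand_tangent x z Hx Hz) as Tx.
  pose proof (cand_tangent y z Hy Hz) as Ty.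
  assert (E : t * (w z + w1 z * (x - z)) + (1 - t) * (w z + w1 z * (y - z)) = w z)
    by (unfold z; ring).
  rewrite <- E; apply Rplus_le_compat; apply Rmult_le_compat_l; lra.
Qed.

(** As [w1] is strictly decreasing, the fit condition makes the set under the infimum the open
    half-line beyond [b]. *)
Lemma cand_b2 : b2_of v = Finite b.
Proof.
  apply is_glb_Rbar_unique; split.
  - intros x [Hx H]; rewrite cand_Derive in H by lra; simpl.
    destruct (Rle_dec b x); [easy | exfalso].
    destruct (cand_fit _ _ _ _ _ _ _ _ Hw) as [[_ F] | [F _]]; [| lra].
    pose proof (cand_derive_decr x b ltac:(lra) ltac:(lra)); lra.
  - pose proof (cand_b _ _ _ _ _ _ _ _ Hw) as Hb.
    assert (Hin : forall x, b < x -> 0 < x /\ Derive v x < 1).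
    { intros x Hx; split; [lra |]; rewrite cand_Derive by lra.
      pose proof (cand_derive_decr b x Hb Hx).
      destruct (cand_fit _ _ _ _ _ _ _ _ Hw); lra. }
    intros [l | |] Hl; simpl; [| | exact I].
    + apply le_epsilon; intros e He; apply (Hl (b + e)), Hin; lra.
    + apply (Hl (b + 1)), Hin; lra.
Qed.

Lemma cand_ratio_decreasing : ratio_decreasing_on (fun x => 0 < x) v.
Proof.
  split.
  - intros x Hx; rewrite cand_Derive_2 by lra.
    pose proof (cand_neg _ _ _ _ _ _ _ _ Hw x); lra.
  - intros x y Hx Hy Hxy; rewrite !cand_Derive, !cand_Derive_2 by lra.
    apply (cand_ratio _ _ _ _ _ _ _ _ Hw); lra.
Qed.

(** At [0] the equation reads [sigma^2 w'' + 2 eta w' = 0]; the ratio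
    [w'/w''] then only decreases. *)
Lemma cand_full_retention (x : R) : 0 <= x -> 0 <= sigma ^ 2 * w2 x + mu * w1 x.
Proof.
  intros Hx; destruct Hw as [_ Hb H0 _ Hpos Hneg Hrat HL _].
  pose proof (HL 0 ltac:(lra)) as E0; rewrite H0 in E0.
  pose proof (Hneg 0 ltac:(lra)) as N0; pose proof (Hneg x Hx) as Nx.
  pose proof (Hpos x Hx) as Px.
  assert (R0 : w1 0 / w2 0 = - (sigma ^ 2 / (2 * eta))).
  { apply (Rmult_eq_reg_r (2 * eta * w2 0)); [| nra].
    field_simplify; [lra | lra | lra]. }
  assert (Rx : w1 x / w2 x <= - (sigma ^ 2 / (2 * eta))).
  { destruct Hx as [Hx | <-]; [| lra].
    pose proof (Hrat 0 x ltac:(lra) Hx); lra. }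
  assert (E1 : w1 x = w1 x / w2 x * w2 x) by (field; lra).
  assert (E2 : 2 * eta * (- (sigma ^ 2 / (2 * eta)) * w2 x) = - sigma ^ 2 * w2 x)
    by (field; lra).
  (* Multiplying [Rx] by the negative [w2 x] reverses it; [2 * eta <= mu] and [0 < w1 x] then
     finish. *)
  assert (G : - (sigma ^ 2 / (2 * eta)) * w2 x <= w1 x) by nra.
  nra.
Qed.

(** Dividing [cand_full_retention] by [sigma ^ 2 * - w2 x > 0] puts every positive [x] in the
    set. *)
Lemma cand_b1 : b1_of mu sigma v = Finite 0.
Proof.
  assert (Hin : forall x, 0 < x ->
    0 < x /\ - (mu / sigma ^ 2) * (Derive v x / Derive_n v 2 x) >= 1).
  { intros x Hx; split; [easy |].
    rewrite cand_Derive, cand_Derive_2 by lra.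
    pose proof (cand_full_retention x ltac:(lra)) as H.
    pose proof (cand_neg _ _ _ _ _ _ _ _ Hw x ltac:(lra)) as N.
    assert (S : 0 < sigma ^ 2) by nra.
    apply Rle_ge.
    replace (- (mu / sigma ^ 2) * (w1 x / w2 x))
      with (1 + (sigma ^ 2 * w2 x + mu * w1 x) / (sigma ^ 2 * - w2 x))
      by (field; lra).
    assert (0 <= (sigma ^ 2 * w2 x + mu * w1 x) / (sigma ^ 2 * - w2 x)); [| lra].
    apply Rdiv_le_0_compat; nra. }
  apply is_glb_Rbar_unique; split.
  - intros x [Hx _]; simpl; lra.
  - intros [l | |] Hl; simpl; [| | exact I].
    + apply le_epsilon; intros e He; rewrite Rplus_0_l; apply (Hl e), Hin; lra.
    + apply (Hl 1), Hin; lra.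
Qed.

(** Here [y] is what remains after a payment out of [x]. The concave function [w y - y] increases up
    to [b] and decreases beyond it, so its maximum over [y <= x] is at [Rmin x b]. *)
Lemma cand_payment (x y : R) : 0 <= y <= x -> w y - y <= w (Rmin x b) - Rmin x b.
Proof.
  intros Hy; pose proof (cand_b _ _ _ _ _ _ _ _ Hw) as Hb.
  assert (Hm : 0 <= Rmin x b) by (apply Rmin_glb; lra).
  pose proof (cand_tangent y (Rmin x b) ltac:(lra) Hm) as T.
  destruct (Rle_dec x b) as [H | H].
  - rewrite Rmin_left in * by lra.
    (* If [b = 0], the slope at [x] is below 1, but then [x = 0] forces [y = x]. *)
    assert (1 <= w1 x \/ x = 0).
    { destruct (cand_fit _ _ _ _ _ _ _ _ Hw) as [[_ F] | [F _]]; [left | lra].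
      rewrite <- F; destruct H as [H | ->]; [| lra].
      apply Rlt_le, cand_derive_decr; lra. }
    assert ((w1 x - 1) * (y - x) <= 0); [| nra].
    destruct H0 as [H0 | H0]; [nra |].
    replace (y - x) with 0 by lra; lra.
  - rewrite Rmin_right in * by lra.
    assert ((w1 b - 1) * (y - b) <= 0); [| nra].
    destruct (cand_fit _ _ _ _ _ _ _ _ Hw) as [[_ ->] | [-> F]]; nra.
Qed.

Lemma cand_HJB : solves_HJB mu eta sigma delta gamma v.
Proof.
  split; [| rewrite Hv by lra; apply (cand_0 _ _ _ _ _ _ _ _ Hw)].
  intros x Hx.
  pose proof (cand_b _ _ _ _ _ _ _ _ Hw) as Hb.
  assert (Hm : 0 <= Rmin x b <= x)
    by (split; [apply Rmin_glb; lra | apply Rmin_l]).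
  assert (E : sigma ^ 2 / 2 * w2 x + eta * w1 x - delta * w x
              + gamma * (x - Rmin x b + w (Rmin x b) - w x) = 0).
  { destruct (Rle_dec x b).
    - rewrite Rmin_left by lra.
      pose proof (cand_left _ _ _ _ _ _ _ _ Hw x ltac:(lra)); nra.
    - rewrite Rmin_right by lra.
      apply (cand_right _ _ _ _ _ _ _ _ Hw); lra. }
  unfold hjb_operand; rewrite cand_Derive, cand_Derive_2 by lra; split.
  - exists 1, (x - Rmin x b); repeat split; try lra.
    rewrite !Hv by lra.
    replace (x - (x - Rmin x b)) with (Rmin x b) by ring; nra.
  - intros y (u & xi & Hu & Hxi & ->).
    rewrite !Hv by lra.
    pose proof (cand_payment x (x - xi) ltac:(lra)) as P.
    pose proof (cand_full_retention x ltac:(lra)) as F.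
    pose proof (cand_neg _ _ _ _ _ _ _ _ Hw x ltac:(lra)) as N.
    (* Since [1 - u ^ 2 = 2 * (1 - u) - (1 - u) ^ 2], the operand at [(u, xi)] falls short of the
       left side of [E] by the quantity in [G], plus that in [Q], plus half of that in [Q']. *)
    assert (G : 0 <= gamma * (w (Rmin x b) - Rmin x b - (w (x - xi) - (x - xi))))
      by (apply Rmult_le_pos; lra).
    assert (S : 0 < sigma ^ 2) by nra.
    assert (Q : 0 <= (1 - u) * (sigma ^ 2 * w2 x + mu * w1 x)) by nra.
    assert (Q' : 0 <= (1 - u) ^ 2 * (sigma ^ 2 * - w2 x))
      by (apply Rmult_le_pos; nra).
    nra.
Qed.

End Verification.

(** * Roots of the characteristic quadratic *)

Lemma quad_root_unique_pos (eta sigma c r s : R) :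
  0 < eta -> 0 < sigma ->
  0 < r -> 0 < s -> quad eta sigma c r = 0 -> quad eta sigma c s = 0 -> r = s.
Proof.
  unfold quad; intros He Hs Hr Hs' Er Es.
  assert (S : 0 < sigma ^ 2) by nra.
  assert (E : (r - s) * (sigma ^ 2 / 2 * (r + s) + eta) = 0) by lra.
  apply Rmult_integral in E; destruct E; nra.
Qed.

Lemma quad_root_unique_neg (eta sigma c r s : R) :
  0 < eta -> 0 < sigma -> 0 < c ->
  r < 0 -> s < 0 -> quad eta sigma c r = 0 -> quad eta sigma c s = 0 -> r = s.
Proof.
  unfold quad; intros He Hs Hc Hr Hs' Er Es.
  assert (S : 0 < sigma ^ 2) by nra.
  assert (E : (r - s) * (sigma ^ 2 / 2 * (r + s) + eta) = 0) by lra.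
  apply Rmult_integral in E; destruct E as [E | E]; [lra | exfalso].
  (* A root satisfies [r * (sigma ^ 2 / 2 * r + eta) = c > 0], so for negative [r] the second factor
     is negative. Adding the two bounds contradicts [E]. *)
  assert (sigma ^ 2 / 2 * r + eta < 0) by nra.
  assert (sigma ^ 2 / 2 * s + eta < 0) by nra.
  lra.
Qed.

Lemma quad_roots (eta sigma c : R) :
  0 < eta -> 0 < sigma -> 0 < c ->
  (exists r, 0 < r /\ quad eta sigma c r = 0)
  /\ (exists r, r < 0 /\ quad eta sigma c r = 0).
Proof.
  intros He Hs Hc.
  assert (S : 0 < sigma ^ 2) by nra.
  (* The square root of the discriminant; it exceeds [eta] because [c > 0], which separates the
     signs of the roots. *)
  set (q := sqrt (eta ^ 2 + 2 * sigma ^ 2 * c)).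
  assert (Hq : q * q = eta ^ 2 + 2 * sigma ^ 2 * c) by (apply sqrt_sqrt; nra).
  assert (H0 : 0 <= q) by apply sqrt_pos.
  assert (Hqe : eta < q) by nra.
  split; [exists ((q - eta) / sigma ^ 2) | exists (- ((q + eta) / sigma ^ 2))]; split.
  - apply Rdiv_lt_0_compat; lra.
  - unfold quad; replace c with ((q * q - eta ^ 2) / (2 * sigma ^ 2))
      by (rewrite Hq; field; lra).
    field; lra.
  - assert (0 < (q + eta) / sigma ^ 2) by (apply Rdiv_lt_0_compat; lra); lra.
  - unfold quad; replace c with ((q * q - eta ^ 2) / (2 * sigma ^ 2))
      by (rewrite Hq; field; lra).
    field; lra.
Qed.

(** * The constants of the problem and the sign of [f1] *)

Section Coefficients.

Context (eta sigma delta : R).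
Context (Heta : 0 < eta) (Hsigma : 0 < sigma) (Hdelta : 0 < delta).

Lemma theta_plus_spec :
  0 < theta_plus eta sigma delta
  /\ quad eta sigma delta (theta_plus eta sigma delta) = 0.
Proof.
  apply (iota_correct (fun r : R => 0 < r /\ quad eta sigma delta r = 0)).
  destruct (quad_roots eta sigma delta) as [[r [Hr E]] _]; try easy.
  exists r; split; [easy |]; intros s [Hs Es].
  now apply (quad_root_unique_pos eta sigma delta).
Qed.

Lemma theta_minus_spec :
  theta_minus eta sigma delta < 0
  /\ quad eta sigma delta (theta_minus eta sigma delta) = 0.
Proof.
  apply (iota_correct (fun r : R => r < 0 /\ quad eta sigma delta r = 0)).
  destruct (quad_roots eta sigma delta) as [_ [r [Hr E]]]; try easy.
  exists r; split; [easy |]; intros s [Hs Es].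
  now apply (quad_root_unique_neg eta sigma delta).
Qed.

Lemma lambda_spec (gamma : R) : 0 < gamma ->
  lambda eta sigma delta gamma < 0
  /\ quad eta sigma (delta + gamma) (lambda eta sigma delta gamma) = 0.
Proof.
  intros Hg.
  apply (iota_correct (fun r : R => r < 0 /\ quad eta sigma (delta + gamma) r = 0)).
  destruct (quad_roots eta sigma (delta + gamma)) as [_ [r [Hr E]]]; try lra.
  exists r; split; [easy |]; intros s [Hs Es].
  apply (quad_root_unique_neg eta sigma (delta + gamma)); lra.
Qed.

Lemma f1_eq (gamma : R) : 0 < gamma ->
  f1 eta sigma delta gamma
  = eta * gamma / (delta * (delta + gamma)) + / lambda eta sigma delta gamma.
Proof.
  intros Hg; destruct (lambda_spec gamma Hg) as [Hl _].
  unfold f1; field; lra.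
Qed.

(** [f1 gamma = 1/lambda - 1/r] with the negative number [r] below, so the sign
    of [f1 gamma] is read off the value at [r] of the quadratic defining
    [lambda]. *)
Lemma f1_factor (gamma : R) : 0 < gamma ->
  exists k, 0 < k /\
    f1 eta sigma delta gamma = k * (gamma - sigma ^ 2 * delta ^ 2 / (2 * eta ^ 2)).
Proof.
  intros Hg; destruct (lambda_spec gamma Hg) as [Hl Q].
  rewrite f1_eq by lra; set (l := lambda eta sigma delta gamma) in *.
  set (r := - (delta * (delta + gamma) / (eta * gamma))).
  assert (Hr : r < 0).
  { assert (0 < delta * (delta + gamma) / (eta * gamma))
      by (apply Rdiv_lt_0_compat; nra).
    unfold r; lra. }
  assert (Qr : quad eta sigma (delta + gamma) r
    = ((delta + gamma) / gamma) ^ 2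
      * (sigma ^ 2 * delta ^ 2 / (2 * eta ^ 2) - gamma))
    by (unfold quad, r; field; lra).
  assert (S : 0 < sigma ^ 2) by nra.
  (* The cofactor of [l - r] in the difference of the quadratic at [r] and at [l]. It is positive:
     [sigma ^ 2 / 2 * l + eta < 0] by the equation for [l], and [r < 0]. *)
  set (m := - (sigma ^ 2 / 2 * (r + l) + eta)).
  assert (D : (l - r) * m = quad eta sigma (delta + gamma) r)
    by (rewrite <- (Rminus_0_r (quad _ _ _ r)), <- Q; unfold quad, m; ring).
  assert (Hm : 0 < m).
  { unfold quad in Q.
    assert (sigma ^ 2 / 2 * l + eta < 0) by nra.
    unfold m; nra. }
  exists (((delta + gamma) / gamma) ^ 2 / (m * (l * r))); split.
  - apply Rdiv_lt_0_compat; [| apply Rmult_lt_0_compat; [easy | nra]].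
    apply pow_lt, Rdiv_lt_0_compat; lra.
  - replace (eta * gamma / (delta * (delta + gamma))) with (- / r)
      by (unfold r; field; lra).
    replace (- / r + / l) with (- ((l - r) * m) / (m * (l * r))) by (field; lra).
    rewrite D, Qr; field; lra.
Qed.

(** By [f1_factor] this is the only positive zero of [f1]; [U] both supplies uniqueness to [iota]
    and identifies the number it picks. *)
Lemma gamma0_eq : gamma0 eta sigma delta = sigma ^ 2 * delta ^ 2 / (2 * eta ^ 2).
Proof.
  assert (P : 0 < sigma ^ 2 * delta ^ 2 / (2 * eta ^ 2))
    by (apply Rdiv_lt_0_compat; repeat apply Rmult_lt_0_compat; lra).
  assert (U : forall g, 0 < g /\ f1 eta sigma delta g = 0 ->
    g = sigma ^ 2 * delta ^ 2 / (2 * eta ^ 2)).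
  { intros g [Hg E]; destruct (f1_factor g Hg) as [k [Hk F]].
    rewrite F in E; apply Rmult_integral in E; lra. }
  apply U.
  apply (iota_correct (fun g : R => 0 < g /\ f1 eta sigma delta g = 0)).
  exists (sigma ^ 2 * delta ^ 2 / (2 * eta ^ 2)); split.
  - split; [easy |]; destruct (f1_factor _ P) as [k [_ ->]]; ring.
  - intros g Hg; symmetry; now apply U.
Qed.

(** This keeps [f1 gamma] within the range on which [g1_inv_spec] inverts [g1]. *)
Lemma f1_lt (gamma : R) : 0 < gamma -> f1 eta sigma delta gamma < eta / delta.
Proof.
  intros Hg; rewrite f1_eq by lra; destruct (lambda_spec gamma Hg) as [Hl _].
  pose proof (Rinv_lt_0_compat _ Hl).
  replace (eta * gamma / (delta * (delta + gamma)))
    with (eta / delta - eta / (delta + gamma)) by (field; lra).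
  assert (0 < eta / (delta + gamma)) by (apply Rdiv_lt_0_compat; lra).
  lra.
Qed.

(** * The function [h1], its derivatives and the inverse of [g1] *)

Let a := theta_plus eta sigma delta.
Let c := theta_minus eta sigma delta.

(** The [n]-th derivative of [h1] in closed form: differentiation only shifts [n]. *)
Definition h1_n (n : nat) (x : R) : R :=
  a ^ n * exp (a * x) - c ^ n * exp (c * x).

Lemma h1_n_0 (x : R) : h1_n 0 x = h1 eta sigma delta x.
Proof. unfold h1_n, h1; fold a c; ring. Qed.

Lemma is_derive_h1_n (n : nat) (x : R) : is_derive (h1_n n) x (h1_n (S n) x).
Proof. unfold h1_n; auto_derive; [easy | simpl; ring]. Qed.

Lemma Derive_h1 (x : R) : Derive (h1 eta sigma delta) x = h1_n 1 x.
Proof.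
  apply is_derive_unique; apply (is_derive_ext _ _ _ _ h1_n_0), is_derive_h1_n.
Qed.

(** Meant for odd [n], since [c < 0 < a]. *)
Lemma h1_n_pos (n : nat) (x : R) : 0 < a ^ n -> c ^ n < 0 -> 0 < h1_n n x.
Proof.
  intros Ha Hc; unfold h1_n.
  pose proof (exp_pos (a * x)); pose proof (exp_pos (c * x)); nra.
Qed.

Lemma h1_1_pos (x : R) : 0 < h1_n 1 x.
Proof.
  destruct theta_plus_spec as [Ha _], theta_minus_spec as [Hc _].
  apply h1_n_pos; unfold a, c; lra.
Qed.

(** The third derivative is positive. Hence concavity to the left of the free boundary follows from
    the sign of [h1''] at the boundary. *)
Lemma h1_2_incr (x y : R) : x <= y -> h1_n 2 x <= h1_n 2 y.
Proof.
  intros Hxy; destruct theta_plus_spec as [Ha _], theta_minus_spec as [Hc _].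
  destruct (mean_value _ _ x y (is_derive_h1_n 2) Hxy) as [z [_ E]].
  fold a in Ha; fold c in Hc; assert (C : 0 < c * c) by nra.
  assert (0 < h1_n 3 z) by (apply h1_n_pos; [now apply pow_lt | nra]).
  nra.
Qed.

Lemma h1_ODE (x : R) :
  sigma ^ 2 / 2 * h1_n 2 x + eta * h1_n 1 x - delta * h1_n 0 x = 0.
Proof.
  destruct theta_plus_spec as [_ Qa], theta_minus_spec as [_ Qc].
  fold a in Qa; fold c in Qc; unfold h1_n.
  transitivity (exp (a * x) * quad eta sigma delta a
                - exp (c * x) * quad eta sigma delta c);
    [unfold quad; ring | rewrite Qa, Qc; ring].
Qed.

(** The decrease of [h1'/h1''], cleared of denominators; the difference of the two sides factors as
    in [E]. *)
Lemma h1_cross (x y : R) : x < y ->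
  h1_n 1 y * h1_n 2 x < h1_n 1 x * h1_n 2 y.
Proof.
  intros Hxy; destruct theta_plus_spec as [Ha _], theta_minus_spec as [Hc _].
  fold a in Ha; fold c in Hc.
  assert (H : exp (a * x + c * y) < exp (a * y + c * x))
    by (apply exp_increasing; nra).
  rewrite !exp_plus in H.
  assert (E : h1_n 1 y * h1_n 2 x - h1_n 1 x * h1_n 2 y
    = a * c * (a - c) * (exp (a * y) * exp (c * x) - exp (a * x) * exp (c * y)))
    by (unfold h1_n; ring).
  assert (AC : a * c < 0) by nra.
  assert (K : a * c * (a - c) < 0) by nra.
  nra.
Qed.

(** With [t = exp (- (a - c) b)], the equation [g1 b = y] is linear in [t]. *)
Lemma g1_inv_spec (y : R) : 0 < y < eta / delta ->
  0 < g1_inv eta sigma delta y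
  /\ h1_n 0 (g1_inv eta sigma delta y) = y * h1_n 1 (g1_inv eta sigma delta y).
Proof.
  intros Hy; destruct theta_plus_spec as [Ha Qa], theta_minus_spec as [Hc _].
  fold a in Ha, Qa; fold c in Hc.
  (* The equation for [a] gives [a * eta < delta], so [y] lies below [1 / a], the supremum of
     [g1]. *)
  assert (Hya : y * a < 1).
  { assert (y * delta < eta).
    { destruct Hy as [_ Hy]; apply (Rmult_lt_compat_r delta) in Hy; [| easy].
      unfold Rdiv in Hy; rewrite Rmult_assoc, Rinv_l in Hy; lra. }
    assert (a * eta < delta).
    { unfold quad in Qa; assert (0 < sigma ^ 2 / 2 * a ^ 2); [| lra].
      repeat apply Rmult_lt_0_compat; lra. }
    apply (Rmult_lt_reg_r eta); nra. }
  assert (Hyc : 1 < 1 - y * c) by nra.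
  assert (G : forall b, g1 eta sigma delta b = y <->
    exp (- (a - c) * b) = (1 - y * a) / (1 - y * c)).
  { intros b; unfold g1; rewrite Derive_h1, <- h1_n_0.
    pose proof (h1_1_pos b) as P; pose proof (exp_pos (a * b)) as Pa.
    assert (Ec : exp (c * b) = exp (a * b) * exp (- (a - c) * b))
      by (rewrite <- exp_plus; f_equal; ring).
    assert (E : h1_n 0 b - y * h1_n 1 b
      = exp (a * b) * (1 - y * a - (1 - y * c) * exp (- (a - c) * b)))
      by (unfold h1_n; rewrite Ec; ring).
    split; intros H.
    - assert (h1_n 0 b - y * h1_n 1 b = 0) by (rewrite <- H; field; lra).
      apply (Rmult_eq_reg_r (1 - y * c)); [| lra].
      field_simplify; [| lra]; nra.
    - rewrite H in E.
      assert (h1_n 0 b = y * h1_n 1 b).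
      { apply Rminus_diag_uniq; rewrite E; field; lra. }
      rewrite H0; field; lra. }
  (* These bounds make [ln t] meaningful and negative, hence the solution [- ln t / (a - c)]
     positive. *)
  assert (Ht : 0 < (1 - y * a) / (1 - y * c) < 1).
  { split; [apply Rdiv_lt_0_compat; lra |].
    apply (Rmult_lt_reg_r (1 - y * c)); [lra |].
    unfold Rdiv; rewrite Rmult_assoc, Rinv_l; nra. }
  set (t := (1 - y * a) / (1 - y * c)) in *.
  assert (I : 0 < g1_inv eta sigma delta y
              /\ g1 eta sigma delta (g1_inv eta sigma delta y) = y).
  { apply (iota_correct (fun b : R => 0 < b /\ g1 eta sigma delta b = y)).
    assert (Hln : ln t < 0) by (rewrite <- ln_1; apply ln_increasing; lra).
    exists (- ln t / (a - c)); split.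
    - split; [apply Rdiv_lt_0_compat; lra | apply G].
      replace (- (a - c) * (- ln t / (a - c))) with (ln t) by (field; lra).
      apply exp_ln; lra.
    - intros b [_ Hb]; apply G in Hb; rewrite <- Hb, ln_exp.
      change (- (- (a - c) * b) / (a - c) = b); field; lra. }
  destruct I as [Hb E]; split; [easy |].
  set (b := g1_inv eta sigma delta y) in *; clearbody b.
  unfold g1 in E; rewrite Derive_h1, <- h1_n_0 in E.
  pose proof (h1_1_pos b); rewrite <- E; field; lra.
Qed.

(** * Solutions beyond the free boundary *)

Context (gamma : R) (Hgamma : 0 < gamma).

Let l := lambda eta sigma delta gamma.
Let k := gamma / (gamma + delta).

(** The solutions with linear growth of the equation that holds beyond the
    free boundary [B], with [C = v B + eta / (gamma + delta)] (see
    [upper_ODE]), and their first two derivatives. *)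
Definition upper0 (A B C x : R) : R := A * exp (l * (x - B)) + k * (x - B + C).
Definition upper1 (A B x : R) : R := A * l * exp (l * (x - B)) + k.
Definition upper2 (A B x : R) : R := A * l ^ 2 * exp (l * (x - B)).

Lemma C2_upper (A B C : R) : C2_with (upper0 A B C) (upper1 A B) (upper2 A B).
Proof.
  split; intros x.
  - unfold upper0, upper1; auto_derive; [easy | unfold Rminus; ring].
  - unfold upper1, upper2; auto_derive; [easy | unfold Rminus; ring].
  - apply (ex_derive_continuous (V := R_NormedModule)); unfold upper2; now auto_derive.
Qed.

Lemma k_pos : 0 < k.
Proof. apply Rdiv_lt_0_compat; lra. Qed.

Lemma upper1_pos (A B x : R) : A < 0 -> 0 < upper1 A B x.
Proof.
  intros HA; destruct (lambda_spec gamma Hgamma) as [Hl _]; fold l in Hl.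
  pose proof k_pos; pose proof (exp_pos (l * (x - B))).
  assert (0 < A * l) by nra; unfold upper1; nra.
Qed.

Lemma upper2_neg (A B x : R) : A < 0 -> upper2 A B x < 0.
Proof.
  intros HA; destruct (lambda_spec gamma Hgamma) as [Hl _]; fold l in Hl.
  pose proof (exp_pos (l * (x - B))).
  assert (0 < l ^ 2) by nra.
  assert (A * l ^ 2 < 0) by nra; unfold upper2; nra.
Qed.

(** The ratio is a constant plus a negative multiple of an exponential that increases because
    [l < 0]. *)
Lemma upper_ratio (A B x y : R) : A < 0 -> x < y ->
  upper1 A B y / upper2 A B y < upper1 A B x / upper2 A B x.
Proof.
  intros HA Hxy; destruct (lambda_spec gamma Hgamma) as [Hl _]; fold l in Hl.
  assert (E : forall z, upper1 A B z / upper2 A B z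
    = / l + k / (A * l ^ 2) * exp (- l * (z - B))).
  { intros z; unfold upper1, upper2.
    replace (- l * (z - B)) with (- (l * (z - B))) by ring; rewrite exp_Ropp.
    pose proof (exp_pos (l * (z - B))); field; lra. }
  rewrite !E.
  assert (exp (- l * (x - B)) < exp (- l * (y - B)))
    by (apply exp_increasing; nra).
  assert (L : 0 < l ^ 2) by nra.
  assert (0 < k / (- A * l ^ 2))
    by (apply Rdiv_lt_0_compat; [apply k_pos | nra]).
  replace (k / (A * l ^ 2)) with (- (k / (- A * l ^ 2))) by (field; lra).
  nra.
Qed.

(** The exponential solves the homogeneous equation since [l] is a root; the shift by
    [eta / (gamma + delta)] makes the affine part a particular solution. Here [C] stands for the
    value at [B] alone. *)
Lemma upper_ODE (A B C x : R) :
  sigma ^ 2 / 2 * upper2 A B x + eta * upper1 A B x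
  - delta * upper0 A B (C + eta / (gamma + delta)) x
  + gamma * (x - B + C - upper0 A B (C + eta / (gamma + delta)) x) = 0.
Proof.
  destruct (lambda_spec gamma Hgamma) as [_ Q]; fold l in Q; unfold quad in Q.
  transitivity (A * exp (l * (x - B))
    * (sigma ^ 2 / 2 * l ^ 2 + eta * l - (delta + gamma))).
  - unfold upper0, upper1, upper2, k; field; lra.
  - rewrite Q; ring.
Qed.

(** * The two candidates *)

(** This is the solution [upper0] with [B = 0], and [A] is chosen so that it vanishes at 0. The
    bound on [gamma] makes [f1 gamma] negative, which is the condition that the slope at 0 be below
    1. *)
Lemma v_small_candidate : gamma < gamma0 eta sigma delta ->
  let A := - (gamma * eta / (gamma + delta) ^ 2) in
  candidate eta sigma delta gamma 0 (v_small eta sigma delta gamma)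
    (upper1 A 0) (upper2 A 0).
Proof.
  intros H A; destruct (lambda_spec gamma Hgamma) as [Hl _].
  assert (HA : A < 0).
  { assert (0 < gamma * eta / (gamma + delta) ^ 2)
      by (apply Rdiv_lt_0_compat; nra).
    unfold A; lra. }
  assert (E : forall x, v_small eta sigma delta gamma x
                        = upper0 A 0 (0 + eta / (gamma + delta)) x).
  { intros x; unfold v_small, upper0; fold l k A; rewrite Rminus_0_r; ring. }
  assert (E0 : v_small eta sigma delta gamma 0 = 0).
  { unfold v_small; rewrite Rmult_0_r, exp_0; field; lra. }
  assert (Hright : forall x,
    sigma ^ 2 / 2 * upper2 A 0 x + eta * upper1 A 0 x
    - delta * v_small eta sigma delta gamma x
    + gamma * (x - 0 + v_small eta sigma delta gamma 0
               - v_small eta sigma delta gamma x) = 0)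
    by (intros x; rewrite E0, E; apply upper_ODE).
  split.
  - destruct (C2_upper A 0 (0 + eta / (gamma + delta))) as [D1 D2 D3].
    split; [| exact D2 | exact D3].
    intros x; apply (is_derive_ext _ _ _ _ (fun t => eq_sym (E t))), D1.
  - lra.
  - exact E0.
  - right; split; [easy |].
    destruct (f1_factor gamma Hgamma) as [q [Hq F]].
    rewrite <- gamma0_eq in F.
    assert (Hf : f1 eta sigma delta gamma < 0) by nra.
    unfold upper1; rewrite Rminus_0_r, Rmult_0_r, exp_0, Rmult_1_r.
    replace (A * l + k)
      with (1 - l * delta / (gamma + delta) * f1 eta sigma delta gamma)
      by (rewrite f1_eq by lra; fold l in Hl |- *; unfold A, k; field; lra).
    assert (0 < - (l * delta) / (gamma + delta))
      by (apply Rdiv_lt_0_compat; fold l in Hl; nra).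
    replace (l * delta / (gamma + delta))
      with (- (- (l * delta) / (gamma + delta))) by (field; lra).
    nra.
  - intros x _; now apply upper1_pos.
  - intros x _; now apply upper2_neg.
  - intros x y _ Hxy; now apply upper_ratio.
  (* Only [x = 0] is left of the boundary, and there the payment term vanishes. *)
  - intros x Hx; pose proof (Hright x) as R; replace x with 0 in * by lra; lra.
  - intros x _; apply Hright.
Qed.

(** The witness [w] glues the two formulas at [b], each taken on the whole line; it departs from [v]
    on the negative reals, where [v] is cut to 0. *)
Lemma v_large_candidate : gamma0 eta sigma delta < gamma ->
  let b := g1_inv eta sigma delta (f1 eta sigma delta gamma) in
  let v := v_large eta sigma delta gamma b in
  exists w w1 w2, candidate eta sigma delta gamma b w w1 w2
                  /\ forall x, 0 <= x -> v x = w x.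
Proof.
  intros H b v; destruct (lambda_spec gamma Hgamma) as [Hl _]; fold l in Hl.
  set (y := f1 eta sigma delta gamma) in *.
  assert (Ey : y = eta * gamma / (delta * (delta + gamma)) + / l)
    by now apply f1_eq.
  assert (Hy : 0 < y < eta / delta).
  { split; [| now apply f1_lt].
    destruct (f1_factor gamma Hgamma) as [q [Hq F]]; fold y in F.
    rewrite <- gamma0_eq in F; nra. }
  destruct (g1_inv_spec y Hy) as [Hb Eb]; fold b in Hb, Eb.
  pose proof (h1_1_pos b) as Pb.
  (* With [h1 b = y * h1' b] and the value of [y], the denominator of [c11] becomes its numerator
     times [h1' b]. *)
  assert (C11 : c11 eta sigma delta gamma b = / h1_n 1 b).
  { unfold c11; fold l; rewrite Derive_h1, <- h1_n_0, Eb.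
    assert (K : 0 < gamma / (gamma + delta) * (1 - eta * l / (gamma + delta))).
    { apply Rmult_lt_0_compat; [apply k_pos |].
      assert (0 < eta * - l / (gamma + delta)) by (apply Rdiv_lt_0_compat; nra).
      replace (eta * l / (gamma + delta)) with (- (eta * - l / (gamma + delta)))
        by (field; lra); lra. }
    replace (h1_n 1 b - delta * l / (gamma + delta) * (y * h1_n 1 b))
      with (gamma / (gamma + delta) * (1 - eta * l / (gamma + delta)) * h1_n 1 b)
      by (rewrite Ey; field; lra).
    field; repeat split; try lra.
    replace (gamma + delta - eta * l) with (- (eta * l) + (gamma + delta)) by ring.
    nra. }
  assert (C12 : c12 eta sigma delta gamma b = delta / (l * (gamma + delta))).
  { unfold c12; rewrite C11, <- h1_n_0, Eb, Ey; field; lra. }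
  set (A := delta / (l * (gamma + delta))) in *.
  assert (HA : A < 0).
  { assert (0 < delta / (- l * (gamma + delta))) by (apply Rdiv_lt_0_compat; nra).
    unfold A; replace (delta / (l * (gamma + delta)))
      with (- (delta / (- l * (gamma + delta)))) by (field; lra); lra. }
  (* The [n]-th derivative of the left piece [c11 * h1]. *)
  set (L n x := / h1_n 1 b * h1_n n x).
  set (R0 := upper0 A b (y + eta / (gamma + delta))).
  assert (E0 : L 0%nat b = R0 b).
  { unfold L, R0, upper0; rewrite Rminus_diag, Rmult_0_r, exp_0, Eb, Rplus_0_l.
    unfold A, k; rewrite Ey; field; lra. }
  assert (Ly : L 0%nat b = y) by (unfold L; rewrite Eb; field; lra).
  assert (L1 : L 1%nat b = 1) by (unfold L; field; lra).
  assert (E1 : L 1%nat b = upper1 A b b).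
  { rewrite L1; unfold upper1; rewrite Rminus_diag, Rmult_0_r, exp_0.
    unfold A, k; field; lra. }
  assert (HL : forall x, sigma ^ 2 / 2 * L 2%nat x + eta * L 1%nat x
                         - delta * L 0%nat x = 0).
  { intros x; unfold L; rewrite <- (Rmult_0_r (/ h1_n 1 b)), <- (h1_ODE x); ring. }
  assert (HR : forall x, sigma ^ 2 / 2 * upper2 A b x + eta * upper1 A b x
                         - delta * R0 x + gamma * (x - b + y - R0 x) = 0)
    by (intros x; apply upper_ODE).
  assert (Hs2 : 0 < sigma ^ 2) by nra.
  assert (E2 : L 2%nat b = upper2 A b b).
  { pose proof (HL b) as E; pose proof (HR b) as E'.
    rewrite <- E0, <- E1, Ly in E'; rewrite Ly in E.
    apply (Rmult_eq_reg_l (sigma ^ 2 / 2)); lra. }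
  assert (L1pos : forall x, 0 < L 1%nat x).
  { intros x; apply Rmult_lt_0_compat; [now apply Rinv_0_lt_compat |].
    apply h1_1_pos. }
  (* By [E2] the left piece takes over at [b] the negative second derivative of the right one;
     monotonicity of [h1''] carries the sign to the left. *)
  assert (L2neg : forall x, x <= b -> L 2%nat x < 0).
  { intros x Hx; apply Rle_lt_trans with (L 2%nat b).
    - apply Rmult_le_compat_l; [now apply Rlt_le, Rinv_0_lt_compat |].
      now apply h1_2_incr.
    - rewrite E2; now apply upper2_neg. }
  assert (Lratio : forall x z, x < z -> z <= b ->
    L 1%nat z / L 2%nat z < L 1%nat x / L 2%nat x).
  { intros x z Hxz Hz.
    pose proof (L2neg x ltac:(lra)) as Nx; pose proof (L2neg z Hz) as Nz.
    assert (X : L 1%nat z * L 2%nat x < L 1%nat x * L 2%nat z).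
    { pose proof (h1_cross x z Hxz) as X.
      pose proof (Rinv_0_lt_compat _ Pb) as I; unfold L.
      assert (0 < / h1_n 1 b * / h1_n 1 b) by nra.
      nra. }
    assert (P : 0 < L 2%nat x * L 2%nat z) by nra.
    apply (Rmult_lt_reg_r (L 2%nat x * L 2%nat z)); [easy |].
    field_simplify; lra. }
  exists (glue b (L 0%nat) R0), (glue b (L 1%nat) (upper1 A b)),
    (glue b (L 2%nat) (upper2 A b)).
  split; [split |].
  - apply C2_with_glue; try easy.
    + assert (D : forall n x, is_derive (L n) x (L (S n) x)).
      { intros n x; apply is_derive_scal, is_derive_h1_n. }
      split; try apply D.
      intros x; apply (ex_derive_continuous (V := R_NormedModule)); exists (L 3%nat x); apply D.
    + apply C2_upper.
  - lra.
  - rewrite glue_lt by lra; unfold L, h1_n; rewrite !Rmult_0_r, exp_0; ring.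
  - left; rewrite glue_le by lra; easy.
  - intros x _; destruct (Rle_dec b x).
    + rewrite glue_ge by lra; now apply upper1_pos.
    + rewrite glue_lt by lra; apply L1pos.
  - intros x _; destruct (Rle_dec b x).
    + rewrite glue_ge by lra; now apply upper2_neg.
    + rewrite glue_lt by lra; apply L2neg; lra.
  - intros x z _ Hxz.
    destruct (Rle_dec z b); [| destruct (Rle_dec b x)].
    + rewrite !glue_le by lra; apply Lratio; lra.
    + rewrite !glue_ge by lra; now apply upper_ratio.
    (* For [x < b < z] the ratios are compared through their common value at [b]. *)
    + rewrite !(glue_ge b _ _ z), !(glue_lt b _ _ x) by lra.
      apply Rlt_trans with (L 1%nat b / L 2%nat b); [| apply Lratio; lra].
      rewrite E1, E2; apply upper_ratio; lra.
  - intros x Hx; rewrite !glue_le by lra; apply HL.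
  - intros x Hx; rewrite !glue_ge by lra; rewrite <- E0, Ly; apply HR.
  - intros x Hx; unfold v, v_large, glue.
    destruct (Rle_dec x 0) as [H0 | H0].
    + replace x with 0 by lra; destruct (Rlt_dec 0 b); [| lra].
      unfold L, h1_n; rewrite !Rmult_0_r, exp_0; ring.
    + rewrite C11, C12, <- !h1_n_0; fold (L 0%nat x) (L 0%nat b) l k.
      rewrite Ly; unfold R0, upper0; destruct (Rlt_dec x b); [easy | ring].
Qed.

End Coefficients.

(** * The two regimes of [gamma] *)

Theorem proposition3p4 (mu eta sigma delta gamma : R)
  (Heta : 0 < eta) (Hmueta : eta < mu) (Hsigma : 0 < sigma)
  (Hdelta : 0 < delta) (Hgamma : 0 < gamma) (Hmu : 2 * eta <= mu) :
  (gamma0 eta sigma delta < gamma ->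
     let b2 := g1_inv eta sigma delta (f1 eta sigma delta gamma) in
     let v := v_large eta sigma delta gamma b2 in
     b2_of v = Finite b2
     /\ C2_on (fun x => 0 < x) v
     /\ increasing_on (fun x => 0 < x) v
     /\ concave_on (fun x => 0 < x) v
     /\ solves_HJB mu eta sigma delta gamma v
     /\ ratio_decreasing_on (fun x => 0 < x) v
     /\ b1_of mu sigma v = Finite 0)
  /\
  (gamma < gamma0 eta sigma delta ->
     let v := v_small eta sigma delta gamma in
     C2_on (fun x => 0 <= x) v
     /\ increasing_on (fun x => 0 <= x) v
     /\ concave_on (fun x => 0 <= x) v
     /\ solves_HJB mu eta sigma delta gamma v
     /\ b2_of v = Finite 0
     /\ ratio_decreasing_on (fun x => 0 < x) v
     /\ b1_of mu sigma v = Finite 0).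
Proof.
  split; intros H.
  - intros b2 v.
    destruct (v_large_candidate eta sigma delta Heta Hsigma Hdelta gamma Hgamma H)
      as (w & w1 & w2 & Hw & Hv); fold b2 v in Hw, Hv.
    refine (conj _ (conj _ (conj _ (conj _ (conj _ (conj _ _)))))).
    + eapply cand_b2; eassumption.
    + eapply C2_on_of_C2; [apply (cand_C2 _ _ _ _ _ _ _ _ Hw) |].
      intros x Hx; eapply cand_agree; eassumption.
    + intros x y Hx Hy; eapply cand_increasing; try eassumption; lra.
    + intros x y t Hx Hy; eapply cand_concave; try eassumption; lra.
    + eapply cand_HJB; eassumption.
    + eapply cand_ratio_decreasing; eassumption.
    + now apply (cand_b1 mu eta sigma delta gamma b2 v w w1 w2).
  - intros v.
    pose proof (v_small_candidate eta sigma delta Heta Hsigma Hdelta gamma Hgamma H)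
      as Hw; fold v in Hw; cbv zeta in Hw.
    (* Here [v] is its own smooth extension to the whole line, so that [C2_on] reaches 0. *)
    assert (Hv : forall x, 0 <= x -> v x = v x) by easy.
    refine (conj _ (conj _ (conj _ (conj _ (conj _ (conj _ _)))))).
    + eapply C2_on_of_C2; [apply (cand_C2 _ _ _ _ _ _ _ _ Hw) |].
      intros x _; apply filter_forall; easy.
    + eapply cand_increasing; eassumption.
    + eapply cand_concave; eassumption.
    + eapply cand_HJB; eassumption.
    + eapply cand_b2; eassumption.
    + eapply cand_ratio_decreasing; eassumption.
    + now apply (cand_b1 mu eta sigma delta gamma 0 v v
        (upper1 eta sigma delta gamma (- (gamma * eta / (gamma + delta) ^ 2)) 0)
        (upper2 eta sigma delta gamma (- (gamma * eta / (gamma + delta) ^ 2)) 0)).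
Qed.
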